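(* Let $A$ be a connected arc of a great circle, of geodesic length $L\in(0,2\pi]$. Let $X=\{x_1,\dots,x_m\}\subset A$ be $m$ equally spaced points on $A$ (with respect to arc-length), indexed in order along $A$, and let $P_X=\frac1m\sum_{j=1}^m\delta_{x_j}$ be the discrete uniform probability measure on them. For each $n\le m$: (i) An optimal $n$-clustering is obtained by partitioning into $n$ contiguous blocks whose sizes differ by at most $1$; the associated block centers form an optimal set of $n$-means. (ii) If $m$ is a multiple of $n$, so each block has $m/n$ points and span $L/n$, then $$V_n(P_X)=\frac{1}{m}\cdot n\sum_{k=-(m/n-1)/2}^{(m/n-1)/2}\left(\frac{kL}{m}\right)^2,$$ which, for large $m$, converges to the continuous value $L^2/(12n^2)$.
   Context: The arc $A$ lies on the unit sphere $\mathbb{S}^2\subset\mathbb{R}^3$. The distortion is the squared geodesic distance $d_G^2$, where $d_G$ is measured along the great circle, i.e. by arc-length; intrinsically, $A$ is regarded as a line segment of length $L$. Quantization: for a metric space $(M,d)$ and a probability measure $P$ on $M$, the distortion of a finite set $\alpha\subset M$ is $V(\alpha;P)=\int_M\min_{a\in\alpha}d(x,a)^2\,dP(x)$, and the $n$th quantization error is $V_n(P)=\inf_{|\alpha|\le n}V(\alpha;P)$; a set $\alpha$ with $|\alpha|\le n$ attaining this infimum is an optimal set of $n$-means. Here $M=A$ and $d=d_G$. A contiguous $n$-clustering partitions $\{1,\dots,m\}$ into $n$ contiguous blocks $B_1=\{1,\dots,k_1\}$, $B_2=\{k_1+1,\dots,k_2\}$, and so on. The center of a block $B$ is any minimizer $a\in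 A$ of $\sum_{j\in B}d_G^2(x_j,a)$ (restricted to $A$). An $n$-clustering is optimal if the total of the squared distances of the points $x_j$ to the centers of their blocks is as small as possible. The ''continuous value'' $L^2/(12n^2)$ is the $n$th quantization error of the uniform distribution on $A$ with respect to arc-length. In the sum, $k$ runs in steps of $1$ between the indicated limits. *)

(* Defs.v *)
From HB Require Import structures.
From mathcomp Require Import all_boot all_order all_algebra.
From mathcomp Require Import all_classical all_reals all_analysis.

Set Implicit Arguments.
Unset Strict Implicit.
Unset Printing Implicit Defensive.

Import Order.TTheory GRing.Theory Num.Theory.
Import numFieldNormedType.Exports.

Local Open Scope classical_set_scope.
Local Open Scope ring_scope.

Section quantization.
Context {R : realType} {d : measure_display} {T : measurableType d}.
Variables (M : set T) (dist : T -> T -> R) (P : {measure set T -> \bar R}).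

(* The infimum over a finite nonempty [a] is a minimum; for empty [a] it is
   +oo, so the empty set never competes in the infimum below. *)
Definition distortion (a : set T) : \bar R :=
  (\int[P]_(x in M) ereal_inf [set ((dist x y) ^+ 2)%:E | y in a])%E.

Definition codebooks (n : nat) : set (set T) :=
  [set a | a `<=` M /\ (a #<= `I_n)%card].

Definition quantization_error (n : nat) : \bar R :=
  ereal_inf [set distortion a | a in codebooks n].

Definition optimal_set_of_means (n : nat) (a : set T) : Prop :=
  codebooks n a /\ distortion a = quantization_error n.

End quantization.

(* Only [x 0], ..., [x m.-1] are used. *)
Definition discrete_uniform {R : realType} {d : measure_display}
    {T : measurableType d} (m : nat) (x : nat -> T) :
    {measure set T -> \bar R} :=
  mscale ((m%:R^-1 : R)%:nng) (msum (fun j => \d_(x j)) m).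

Lemma discrete_uniform_setT {R : realType} {d : measure_display}
    {T : measurableType d} (m : nat) (x : nat -> T) :
  (0 < m)%N -> @discrete_uniform R d T m x setT = 1%E.
Proof.
move=> m0; rewrite /discrete_uniform/= /mscale/= /msum/=.
under eq_bigr do rewrite diracT.
rewrite sumEFin sumr_const card_ord -EFinM mulVf //.
by rewrite pnatr_eq0 -lt0n.
Qed.

Section clustering.
Context {R : realType} {T : Type}.
Variables (M : set T) (dist : T -> T -> R) (m : nat) (x : nat -> T).

Definition clustering (n : nat) (B : {set {set 'I_m}}) : Prop :=
  finset.partition B [set: 'I_m] /\ #|B| = n.

(* The blocks are {k 0, ..., k 1 - 1}, {k 1, ..., k 2 - 1}, ...; the indices
   are shifted down by one, points being numbered from 0. *)
Definition contiguous (n : nat) (B : {set {set 'I_m}}) : Prop :=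
  exists k : nat -> nat,
    [/\ k 0%N = 0%N, k n = m, (forall i, (i < n)%N -> (k i < k i.+1)%N) &
        B = [set [set j : 'I_m | (k i <= j < k i.+1)%N] | i : 'I_n]%SET].

Definition balanced (B : {set {set 'I_m}}) : Prop :=
  forall b b' : {set 'I_m}, b \in B -> b' \in B -> (#|b| <= #|b'| + 1)%N.

Definition is_center (b : {set 'I_m}) (a : T) : Prop :=
  M a /\ forall a', M a' ->
    \sum_(j in b) (dist (x j) a) ^+ 2 <= \sum_(j in b) (dist (x j) a') ^+ 2.

Definition are_centers (B : {set {set 'I_m}}) (c : {set 'I_m} -> T) : Prop :=
  forall b, b \in B -> is_center b (c b).

Definition clustering_cost (B : {set {set 'I_m}}) (c : {set 'I_m} -> T) : R :=
  \sum_(b in B) \sum_(j in b) (dist (x j) (c b)) ^+ 2.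

(* Centers need not be unique in general, but the cost does not depend on
   which ones are taken.  The competitors are all [n]-clusterings, contiguous
   or not. *)
Definition optimal_clustering (n : nat) (B : {set {set 'I_m}}) : Prop :=
  clustering n B /\
  exists2 c, are_centers B c & forall B' c',
    clustering n B' -> are_centers B' c' ->
    clustering_cost B c <= clustering_cost B' c'.

End clustering.

(* Euclidean 3-space with its Borel sigma-algebra. *)
Definition space3 (R : realType) :=
  g_sigma_algebraType (@open 'rV[R]_3).

Section circle_arc.
Context {R : realType}.

Definition dot (u v : 'rV[R]_3) : R := (u *m v^T) 0 0.

Definition orthonormal_pair (u v : 'rV[R]_3) : Prop :=
  [/\ dot u u = 1, dot v v = 1 & dot u v = 0].

Variables (u v : 'rV[R]_3) (L : R).

(* For orthonormal [u], [v], this is the arc-length parametrization of the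
   great circle of the unit sphere in the plane spanned by [u] and [v]. *)
Definition great_circle (t : R) : space3 R := cos t *: u + sin t *: v.

Definition circle_arc : set (space3 R) := great_circle @` `[0, L].

(* The position of a point along the arc, measured from its origin [u].  It is
   the only parameter of the point, except that if L = 2 pi then [u] has the
   two parameters 0 and L, of which 0 is chosen: the full circle is cut open
   at [u]. *)
Definition arc_coord (y : space3 R) : R :=
  inf [set t | t \in `[0, L] /\ great_circle t = y].

(* Arc-length along the arc, which for L > pi may exceed the distance on the
   sphere: the arc is treated as a line segment. *)
Definition dG (y z : space3 R) : R := `|arc_coord y - arc_coord z|.

(* The arc is divided into [m] cells of length L / m, each carrying one point
   at the same relative position (for example the midpoint). *)
Definition equally_spaced (m : nat) (x : nat -> space3 R) : Prop :=
  exists c : R, forall j, (j < m)%N ->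
    circle_arc (x j) /\ arc_coord (x j) = c + j%:R * (L / m%:R).

End circle_arc.

(* Main.v *)
(* In the arc-length coordinate the points are c + j h with h = L / m.  A set of
   k distinct integers has moment of inertia at least k (k^2 - 1) / 12 about any
   point: removing the least element a and the greatest element b removes at
   least (b - a)^2 / 2 >= (k - 1)^2 / 2.  Equality holds for k consecutive
   integers about their mean, which is realized by a point of the arc.  Since
   k (k^2 - 1) / 12 is convex in k and lies above its secant through p and
   p + 1, the total over n blocks is least when all sizes are p or p + 1; empty
   blocks only increase it, so codebooks with fewer than n points do not help. *)
Require Import Defs.
From mathcomp Require Import all_boot all_order all_algebra.
From mathcomp Require Import all_classical all_reals all_analysis.
From mathcomp Require Import measurable_realfun ring lra zify.

Import Order.TTheory GRing.Theory Num.Theory.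
Import numFieldNormedType.Exports.

Local Open Scope classical_set_scope.
Local Open Scope ring_scope.

(** * Sums over blocks of consecutive indices *)

Lemma big_ord_block {T : Type} {idx : T} {op : Monoid.law idx} {m : nat}
    (k l : nat) (F : nat -> T) : (k + l <= m)%N ->
  \big[op/idx]_(j in [set j : 'I_m | (k <= j < k + l)%N]%SET) F j =
  \big[op/idx]_(i < l) F (k + i)%N.
Proof.
move=> klm; transitivity (\big[op/idx]_(0 + k <= i < k + l) F i).
  rewrite add0n (big_nat_widen _ _ m)// big_geq_mkord.
  by apply: eq_bigl => j; rewrite inE andbC.
by rewrite big_addn addKn big_mkord; apply: eq_bigr => i _; rewrite addnC.
Qed.

Lemma card_ord_block {m : nat} (k l : nat) : (k + l <= m)%N ->
  #|[set j : 'I_m | (k <= j < k + l)%N]%SET| = l.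
Proof.
move=> klm; rewrite -sum1_card (big_ord_block _ _ (fun=> 1%N))//.
by rewrite sum1_card card_ord.
Qed.

(** * Moments of inertia of finite sets of integers *)

Section inertia.
Context {R : realFieldType}.

Definition inertia (k : nat) : R := k%:R * (k%:R ^+ 2 - 1) / 12.

(** Parallel axis theorem: (l - 1) / 2 is the mean of 0, ..., l - 1, and the last term is the cost
    of measuring from [s] instead of the mean. *)
Lemma sum_sqr_ord (l : nat) (s : R) :
  \sum_(i < l) (i%:R - s) ^+ 2 =
  inertia l + l%:R * (s - (l%:R - 1) / 2) ^+ 2.
Proof.
elim: l => [|l IH]; first by rewrite big_ord0 /inertia; ring.
by rewrite big_ord_recr/= IH /inertia -natr1; field.
Qed.

(** The left side is the secant through p and p + 1, of slope [inertia p.+1 - inertia p]. The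
    difference of the two sides has the factor (k - p) (k - (p + 1)), which is nonnegative because
    no integer lies strictly between p and p + 1. *)
Lemma inertia_tangent (p k : nat) :
  inertia p + (k%:R - p%:R) * (p%:R * (p%:R + 1) / 4) <= inertia k.
Proof.
rewrite -subr_ge0.
have -> : inertia k - (inertia p + (k%:R - p%:R) * (p%:R * (p%:R + 1) / 4)) =
    (k%:R - p%:R) * (k%:R - (p%:R + 1)) * (k%:R + 2 * p%:R + 1) / 12 :> R.
  by rewrite /inertia; field.
have kp0 : 0 <= k%:R + 2 * p%:R + 1 :> R by rewrite !addr_ge0 ?mulr_ge0.
rewrite divr_ge0// mulr_ge0// {kp0}.
have [kp|pk] := leqP k p.
  have kpR : k%:R <= p%:R :> R by rewrite ler_nat.
  by rewrite mulr_le0//; lra.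
have : p.+1%:R <= k%:R :> R by rewrite ler_nat.
by rewrite -natr1 => ?; rewrite mulr_ge0//; lra.
Qed.

Lemma inertia_tangent_eq (p k : nat) : (p <= k <= p.+1)%N ->
  inertia k = inertia p + (k%:R - p%:R) * (p%:R * (p%:R + 1) / 4).
Proof.
move=> /andP[pk kp]; have [->|kNp] := eqVneq k p; first by ring.
have -> : k = p.+1 by lia.
by rewrite /inertia -natr1; field.
Qed.

Lemma inertia_le_sum_sqr {m : nat} (b : {set 'I_m}) (s : R) :
  inertia #|b| <= \sum_(j in b) (j%:R - s) ^+ 2.
Proof.
(* Strong induction on the size of [b], since two elements are removed at a time. *)
have [k] := ubnP #|b|; elim: k => // k IH in b *; rewrite ltnS => bk.
have [->|[j0 j0b]] := set_0Vmem b.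
  by rewrite cards0 /inertia !mul0r sumr_ge0// => j _; rewrite sqr_ge0.
have [a ab amin] : exists2 a, a \in b & forall j, j \in b -> (a <= j)%N.
  by case: (arg_minnP (fun j : 'I_m => nat_of_ord j) j0b) => a; exists a.
have [c cb cmax] : exists2 c, c \in b & forall j, j \in b -> (j <= c)%N.
  by case: (arg_maxnP (fun j : 'I_m => nat_of_ord j) j0b) => c; exists c.
(* Subtracting [a] embeds [b] into the integers from 0 to c - a. *)
have card_le : (#|b| <= c - a + 1)%N.
  rewrite addn1 -[X in (_ <= X)%N]card_ord.
  rewrite -(@card_in_imset _ _ (fun j : 'I_m => inord (j - a) : 'I_(c - a).+1)).
    exact: max_card.
  move=> i j ib jb /(congr1 (@nat_of_ord _)).
  rewrite !inordK ?ltnS ?leq_sub2r ?cmax// => ij; apply: val_inj => /=.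
  by have := amin _ ib; have := amin _ jb; lia.
have ac := amin _ cb.
(* If the extremes coincide, [b] is a singleton, of inertia 0, and there is no pair to remove. *)
have [ceqa|cNa] := eqVneq c a.
  have -> : #|b| = 1%N.
    have : (0 < #|b|)%N by apply/card_gt0P; exists j0.
    by move: card_le; rewrite ceqa subnn; lia.
  rewrite (_ : inertia 1 = 0) ?sumr_ge0// => [j _|]; first by rewrite sqr_ge0.
  by rewrite /inertia; ring.
rewrite (big_setD1 a)//= (big_setD1 c)/=; last by rewrite !inE cNa.
have card_b : #|b| = #|b :\ a :\ c|.+2.
  by rewrite (cardsD1 a) ab (cardsD1 c) !inE cNa cb.
have /IH Sl : (#|b :\ a :\ c| < k)%N by rewrite card_b in bk; exact: ltnW.
set S := \sum_(_ in _) _ in Sl *; set l := #|_ :\ c| in card_b Sl *.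
have gap : l%:R + 1 <= c%:R - a%:R :> R.
  by rewrite -natrB// natr1 ler_nat -ltnS -(addn1 (c - a)) -card_b.
rewrite card_b -/l.
have -> : inertia l.+2 = inertia l + (l%:R + 1) ^+ 2 / 2 :> R.
  by rewrite /inertia -[in LHS]natr1 -[in LHS]natr1; field.
have l0 : 0 <= l%:R :> R by [].
have : (l%:R + 1) ^+ 2 <= (c%:R - a%:R) ^+ 2 :> R.
  by rewrite lerXn2r// nnegrE; lra.
have : 0 <= (a%:R + c%:R - 2 * s) ^+ 2 by rewrite sqr_ge0.
(* The pair a, c contributes half of (a + c - 2 s)^2 + (c - a)^2. The first square is dropped; the
   second is at least (l + 1)^2, which pays for the growth of the inertia from l to l + 2. *)
have -> : (a%:R - s) ^+ 2 + ((c%:R - s) ^+ 2 + S) =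
    S + ((a%:R + c%:R - 2 * s) ^+ 2 + (c%:R - a%:R) ^+ 2) / 2 by field.
by move: (inertia l) Sl => i Sl; lra.
Qed.

(* The total inertia of [n] blocks of consecutive integers with sizes [p] or
   [p + 1] and sizes summing to [m]. *)
Definition balanced_inertia (n m p : nat) : R :=
  n%:R * inertia p + (m%:R - n%:R * p%:R) * (p%:R * (p%:R + 1) / 4).

(** The secant bound is affine in the block size, so its sum depends only on the number of blocks
    and the total size. The sizes may be 0 and [p] is arbitrary. *)
Lemma balanced_inertia_le (I : finType) (n m p : nat) (P : pred I)
    (k : I -> nat) : #|P| = n -> (\sum_(i | P i) k i)%N = m ->
  balanced_inertia n m p <= \sum_(i | P i) inertia (k i).
Proof.
move=> Pn km; apply: le_trans (ler_sum _ (fun i _ => inertia_tangent p (k i))).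
rewrite big_split/= sumr_const -mulr_suml sumrB sumr_const Pn.
by rewrite -natr_sum km /balanced_inertia -(mulr_natl (inertia p)) -(mulr_natl p%:R).
Qed.

Lemma balanced_inertia_eq (I : finType) (n m p : nat) (P : pred I)
    (k : I -> nat) : #|P| = n -> (\sum_(i | P i) k i)%N = m ->
    (forall i, P i -> (p <= k i <= p.+1)%N) ->
  \sum_(i | P i) inertia (k i) = balanced_inertia n m p.
Proof.
move=> Pn km kp.
rewrite (eq_bigr _ (fun i Pi => inertia_tangent_eq p (k i) (kp i Pi))).
rewrite big_split/= sumr_const -mulr_suml sumrB sumr_const Pn.
by rewrite -natr_sum km /balanced_inertia -(mulr_natl (inertia p)) -(mulr_natl p%:R).
Qed.

Lemma balanced_inertia_dvd (n q : nat) :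
  balanced_inertia n (n * q) q = n%:R * inertia q.
Proof. by rewrite /balanced_inertia natrM subrr mul0r addr0. Qed.

Lemma sum_sqr_block {m : nat} (k l : nat) (s : R) : (k + l <= m)%N ->
  \sum_(j in [set j : 'I_m | (k <= j < k + l)%N]%SET) (j%:R - s) ^+ 2 =
  inertia l + l%:R * (s - (k%:R + (l%:R - 1) / 2)) ^+ 2.
Proof.
move=> klm; rewrite (big_ord_block _ _ (fun j => (j%:R - s) ^+ 2))//.
transitivity (\sum_(i < l) (i%:R - (s - k%:R)) ^+ 2 : R).
  by apply: eq_bigr => i _; rewrite natrD; congr (_ ^+ 2); ring.
by rewrite sum_sqr_ord; congr (_ + _ * _ ^+ 2); ring.
Qed.

End inertia.

(** * Balanced contiguous clusterings: block sizes and existence *)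

Section blocks.
Context {m n : nat}.
Implicit Types (B : {set {set 'I_m}}) (b : {set 'I_m}).

Lemma clustering_sum_card {B} : clustering n B -> (\sum_(b in B) #|b|)%N = m.
Proof. by move=> [/finset.card_partition<- _]; rewrite finset.cardsT card_ord. Qed.

Lemma contiguous_block {B b} : clustering n B -> contiguous n B -> b \in B ->
  exists k l, [/\ (0 < l)%N, (k + l <= m)%N &
    b = [set j : 'I_m | (k <= j < k + l)%N]%SET].
Proof.
move=> [/and3P[_ _ B0] _] [k [_ _ _ eB]] bB.
have /finset.imsetP[i _ eb] : b \in [set [set j : 'I_m | (k i <= j < k i.+1)%N] | i : 'I_n]%SET.
  by rewrite -eB.
have [j jb] : exists j, j \in b.
  by apply/set0Pn; apply: contraNneq B0 => <-.
move: (jb); rewrite eb inE => kj; have jm := ltn_ord j.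
(* Cutting off at [m] changes no block, since all indices are below [m], and gives the bound on
   [k + l] without an appeal to monotonicity of the cuts. *)
exists (k i), (minn (k i.+1) m - k i)%N; split; [lia|lia|].
apply/finset.setP => t; rewrite !inE; have := ltn_ord t; lia.
Qed.

Lemma balanced_card {B b} : clustering n B -> balanced B -> b \in B ->
  (m %/ n <= #|b| <= (m %/ n).+1)%N.
Proof.
move=> clB balB bB; have Bn := clB.2.
have n0 : (0 < n)%N by rewrite -Bn; apply/card_gt0P; exists b.
case: (arg_minnP (fun b : {set 'I_m} => #|b|) bB) => b0 b0B b0min.
(* With r the least size, every size is r or r + 1 and [b0] itself has size r, so n r <= m < n (r +
   1). *)
have -> : (m %/ n = #|b0|)%N.
  apply/eqP; rewrite eqn_leq -ltnS ltn_divLR// leq_divRL//.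
  apply/andP; split.
    rewrite -[X in (X < _)%N](clustering_sum_card clB) -Bn mulnC -sum_nat_const.
    rewrite (bigD1 b0)//= [X in (_ < X)%N](bigD1 b0)//= -addSn.
    by rewrite leq_add// leq_sum// => b' /andP[b'B _]; rewrite -addn1 balB.
  rewrite -[X in (_ <= X)%N](clustering_sum_card clB) -Bn mulnC -sum_nat_const.
  exact: leq_sum.
by rewrite b0min// -addn1 balB.
Qed.

(** Each of the n sizes is at least m / n and they sum to n (m / n), so equality holds in every
    block. *)
Lemma balanced_card_dvd {B b} : clustering n B -> balanced B -> b \in B ->
  (n %| m)%N -> #|b| = (m %/ n)%N.
Proof.
move=> clB balB bB nm.
have := leqif_sum (fun b' (b'B : b' \in B) => leqif_eq (proj1 (andP (balanced_card clB balB b'B)))).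
rewrite clustering_sum_card// sum_nat_const clB.2 mulnC divnK//.
move=> [_]; rewrite eqxx => /esym/forall_inP/(_ _ bB)/eqP.
by [].
Qed.

Definition balanced_cut (i : nat) : nat := (i * m %/ n)%N.

(** The integer quotient of i m + m by n is the sum of the two quotients plus a carry of 0 or 1. *)
Lemma balanced_cut_gap (i : nat) : (0 < n)%N ->
  (m %/ n <= balanced_cut i.+1 - balanced_cut i <= (m %/ n).+1)%N.
Proof.
move=> n0; rewrite /balanced_cut mulSn addnC divnD// -addnA addKn.
by case: (n <= _)%N; rewrite ?addn0 ?addn1 leqnn leqnSn.
Qed.

Lemma ex_balanced_clustering : (0 < n)%N -> (n <= m)%N ->
  exists B, [/\ clustering n B, contiguous n B & balanced B].
Proof.
(* From n <= m every gap is positive, so the cuts increase strictly and no block is empty. *)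
move=> n0 nm; have q0 : (0 < m %/ n)%N by rewrite divn_gt0.
pose k := balanced_cut; pose blk i : {set 'I_m} := [set j : 'I_m | (k i <= j < k i.+1)%N]%SET.
have k0 : k 0%N = 0%N by rewrite /k /balanced_cut mul0n div0n.
have kn : k n = m by rewrite /k /balanced_cut mulKn.
have kS i : (k i < k i.+1)%N by have := balanced_cut_gap i n0; rewrite -/k; lia.
have k_mono : {homo k : i j / (i <= j)%N}.
  by apply: homo_leq => // [j i l|i]; [exact: leq_trans|exact/ltnW].
have km i : (i < n)%N -> (k i.+1 <= m)%N by move=> lt_in; rewrite -kn k_mono.
have blkE i : blk i = [set j : 'I_m | (k i <= j < k i + (k i.+1 - k i))%N]%SET.
  by rewrite subnKC// ltnW.
have card_blk i : (i < n)%N -> #|blk i| = (k i.+1 - k i)%N.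
  by move=> lt_in; rewrite blkE card_ord_block// subnKC ?km// ltnW.
have blk_inj i i' (j : 'I_m) : j \in blk i -> j \in blk i' -> i = i'.
  rewrite !inE => /andP[kij jki] /andP[ki'j jki'].
  have [ii'|i'i|//] := ltngtP i i'.
    by have := leq_trans jki (leq_trans (k_mono _ _ ii') ki'j); rewrite ltnn.
  by have := leq_trans jki' (leq_trans (k_mono _ _ i'i) kij); rewrite ltnn.
have blk_neq0 (i : 'I_n) : exists j, j \in blk i.
  apply/card_gt0P; rewrite card_blk// subn_gt0; exact: kS.
exists [set blk i | i : 'I_n]%SET; split.
- split; last first.
    rewrite card_imset ?card_ord// => i i' ii'; apply: val_inj => /=.
    have [j ji] := blk_neq0 i; apply: (blk_inj _ _ _ ji); by rewrite -ii'.
  apply/and3P; split.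
  + apply/eqP/finset.setP => j; rewrite !inE; apply/finset.bigcupP.
    have [i lt_in ij] : exists2 i, (i < n)%N & j \in blk i.
      have : (j < k n)%N by rewrite kn.
      elim: n => [|i IH]; first by rewrite k0.
      have [ji _|ij jiS] := ltnP j (k i).
        by have [i' i'i ji'] := IH ji; exists i' => //; exact: ltnW.
      by exists i => //; rewrite inE ij.
    by exists (blk i) => //; apply/finset.imsetP; exists (Ordinal lt_in).
  + apply/finset.trivIsetP => _ _ /finset.imsetP[i _ ->] /finset.imsetP[i' _ ->] ii'.
    rewrite -setI_eq0; apply/eqP/finset.setP => j; rewrite finset.in_set0.
    apply/negP; rewrite finset.in_setI => /andP[ji ji']; move: ii'.
    by rewrite (blk_inj _ _ _ ji ji') eqxx.
  + apply/finset.imsetP => -[i _ i0]; have [j] := blk_neq0 i.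
    by rewrite -i0 inE.
- by exists k; split.
- move=> _ _ /finset.imsetP[i _ ->] /finset.imsetP[i' _ ->].
  rewrite !card_blk//.
  have := balanced_cut_gap i n0; have := balanced_cut_gap i' n0.
  rewrite -/k; lia.
Qed.

End blocks.

(** * Integration against the discrete uniform measure *)

Lemma integral_discrete_uniform {R : realType} {d : measure_display}
    {T : measurableType d} (m : nat) (x : nat -> T) (D : set T)
    (f : T -> \bar R) :
  measurable D -> measurable_fun D f -> (forall y, D y -> (0 <= f y)%E) ->
  (forall j, (j < m)%N -> D (x j)) ->
  (\int[discrete_uniform m x]_(y in D) f y = (m%:R^-1)%:E * \sum_(j < m) f (x j))%E.
Proof.
move=> mD mf f0 xD; rewrite ge0_integral_mscale//= ge0_integral_measure_sum//.
congr (_ * _)%E; apply: eq_bigr => j _.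
by rewrite integral_dirac// diracE mem_set ?mul1e//; exact: xD.
Qed.

(** * The arc-length coordinate: attainment, consistency along the arc, measurability *)

Section arc.
Context {R : realType} {u v : 'rV[R]_3} {L : R}.
Local Notation G := (great_circle u v).
Local Notation A := (circle_arc u v L).
Local Notation s := (arc_coord u v L).

Lemma continuous_great_circle : continuous (G : R -> 'rV[R]_3).
Proof.
move=> t; apply: cvgD; apply: cvgZr_tmp.
  exact: continuous_cos.
exact: continuous_sin.
Qed.

(** The parameters of [y] form a nonempty compact set, so the infimum defining [arc_coord] is
    attained. *)
Lemma arc_coordP y : A y -> 0 <= s y <= L /\ G (s y) = y.
Proof.
move=> Ay; set S : set R := [set t | t \in `[0, L] /\ G t = y].
have cS : compact S.
  have -> : S = `[0, L] `&` G @^-1` [set y].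
    by apply/seteqP; split=> t /=; rewrite inE.
  apply: compact_closedI; first exact: segment_compact.
  apply: (@closed_comp _ _ (G : R -> 'rV[R]_3)).
    by move=> t _; exact: continuous_great_circle.
  exact: accessible_closed_set1 (hausdorff_accessible (@norm_hausdorff _ _)) _.
have S0 : S !=set0.
  by case: Ay => t tL ty; exists t; split.
have cid : {within S, continuous (@idfun R)}.
  by apply: continuous_subspaceT => t; exact: cvg_id.
have [c /set_mem cSc cmin] := compact_EVT_min S0 cS cid.
have -> : s y = c.
  apply/eqP; rewrite eq_le; apply/andP; split.
    by apply: ge_inf => //; exists c => t tS; apply: cmin; rewrite inE.
  by apply: lb_le_inf => // t tS; apply: cmin; rewrite inE.
by case: cSc; rewrite in_itv.
Qed.

Lemma arc_coord_le t : 0 <= t <= L -> s (G t) <= t.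
Proof.
move=> tL; apply: ge_inf; last by rewrite /= in_itv.
by exists 0 => r /= []; rewrite in_itv => /andP[].
Qed.

Lemma circle_arc_great_circle t : 0 <= t <= L -> A (G t).
Proof. by move=> tL; exists t => //=; rewrite in_itv. Qed.

Hypothesis uv : orthonormal_pair u v.

(** By orthonormality the dot products with [u] and [v] recover cosine and sine, and the addition
    formulas then carry the equality over to every rotation. *)
Lemma great_circle_shift r t h : G r = G t -> G (r + h) = G (t + h).
Proof.
case: uv => uu vv uv0 rt.
have dotG w t' : dot w (G t') = cos t' * dot w u + sin t' * dot w v.
  by rewrite /dot /great_circle linearD/= !linearZ/= mulmxDr -!scalemxAr !mxE.
have vu0 : dot v u = 0.
  by rewrite -uv0 /dot -[v *m _]trmxK trmx_mul trmxK mxE.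
have crt : cos r = cos t.
  have := congr1 (dot u) rt; rewrite !dotG uu uv0; lra.
have srt : sin r = sin t.
  have := congr1 (dot v) rt; rewrite !dotG vv vu0; lra.
by rewrite /great_circle !cosD !sinD crt srt.
Qed.

(* If [G t] had a parameter [r < t], rotating by [s y - t] would give [y] the
   parameter [s y - (t - r) < s y]. *)
Lemma arc_coordK y t : A y -> 0 <= t <= s y -> s (G t) = t.
Proof.
move=> Ay /andP[t0 ty]; have [/andP[y0 yL] Gy] := arc_coordP _ Ay.
have tL : 0 <= t <= L by rewrite t0 (le_trans ty).
have [/andP[r0 rL] Gr] := arc_coordP _ (circle_arc_great_circle _ tL).
have rt := arc_coord_le _ tL.
set r := s (G t) in r0 rL Gr rt *.
apply/eqP; rewrite eq_le rt/=.
have e : G (r + (s y - t)) = y.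
  by rewrite (great_circle_shift _ _ _ Gr) addrC subrK.
have : s (G (r + (s y - t))) <= r + (s y - t).
  by apply: arc_coord_le; apply/andP; split; lra.
rewrite e; lra.
Qed.

Lemma measurable_great_circle_itv (t : R) :
  measurable (G @` `[0, t] : set (space3 R)).
Proof.
have : @closed 'rV[R]_3 (G @` `[0, t]).
  apply: compact_closed; first exact: norm_hausdorff.
  apply: continuous_compact; last exact: segment_compact.
  exact: (continuous_subspaceT continuous_great_circle).
move=> /closed_openC oC.
rewrite -[X in measurable X]setCK; apply: measurableC.
exact: sub_sigma_algebra.
Qed.

Lemma measurable_circle_arc : measurable (A : set (space3 R)).
Proof. exact: measurable_great_circle_itv. Qed.

(** On the full circle the coordinate jumps at [u], so continuity cannot be invoked. As it is the
    least parameter, it is at most [t] exactly on the image of [0, min t L], which is compact; the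
    set where it exceeds [t] is the rest of the arc. *)
Lemma measurable_arc_coord : measurable_fun (A : set (space3 R)) s.
Proof.
move=> mA; apply: (measurability _ (RGenOInfty.measurableE R)) => //.
move=> _ [_ [t ->] <-].
have -> : A `&` s @^-1` `]t, +oo[ = A `\` G @` `[0, Num.min t L].
  apply/seteqP; split=> y /= [Ay].
    rewrite in_itv/= andbT => ty; split=> // -[r].
    rewrite /= in_itv/= le_min => /and3P[r0 rt rL] ry.
    by have := arc_coord_le r; rewrite r0 rL ry => /(_ isT); lra.
  move=> nGy; split=> //; rewrite in_itv/= andbT ltNge; apply/negP => yt.
  have [/andP[y0 yL] Gy] := arc_coordP _ Ay.
  by apply: nGy; exists (s y) => //=; rewrite in_itv/= y0 le_min yt.
by apply: measurableD => //; exact: measurable_great_circle_itv.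
Qed.

Lemma measurable_sqr_dist_to (a : set (space3 R)) : finite_set a ->
  measurable_fun A
    (fun x => ereal_inf [set ((dG u v L x y) ^+ 2)%:E | y in a]).
Proof.
move=> fina; have [->|a0] := eqVneq a set0.
  under eq_fun do rewrite image_set0 ereal_inf0.
  exact: measurable_cst.
have /pfcard_geP[a_eq0|] := finite_set_countable fina.
  by rewrite a_eq0 eqxx in a0.
(* A nonempty finite set is the range of a sequence, which turns the infimum into a countable one of
   measurable functions. *)
move=> /surjfunPex[e ->].
rewrite (_ : (fun x => _) =
    (fun x => einfs (fun k => ((dG u v L x (e k)) ^+ 2)%:E) 0%N)).
  apply: measurable_fun_einfs => k.
  apply/measurable_EFinP/measurable_funX; apply: measurableT_comp => //.
  exact: measurable_funB measurable_arc_coord _.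
apply/funext => x; congr ereal_inf; apply/seteqP; split=> r.
  by move=> [_ [k _ <-] <-]; exists k.
by move=> [k _ <-]; exists (e k) => //; exists k.
Qed.

End arc.

(** * Clustering cost and quantization error of equally spaced points *)

Section equally_spaced_points.
Context {R : realType} {u v : 'rV[R]_3} {L c : R} {m : nat}.
Context {x : nat -> space3 R}.
Hypothesis uv : orthonormal_pair u v.
Hypothesis L0 : 0 < L.
Hypothesis m0 : (0 < m)%N.
Local Notation A := (circle_arc u v L).
Local Notation s := (arc_coord u v L).
Local Notation d := (dG u v L).
Local Notation h := (L / m%:R).
Local Notation PX :=
  (discrete_uniform m x : {measure set (space3 R) -> \bar R}).
Hypothesis x_spaced : forall j, (j < m)%N -> A (x j) /\ s (x j) = c + j%:R * h.

Lemma sum_sqr_distE (b : {set 'I_m}) (y : space3 R) :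
  \sum_(j in b) (d (x j) y) ^+ 2 =
  h ^+ 2 * \sum_(j in b) (j%:R - (s y - c) / h) ^+ 2.
Proof.
have mR : m%:R != 0 :> R by rewrite pnatr_eq0 -lt0n.
rewrite mulr_sumr; apply: eq_bigr => j _.
rewrite /dG (x_spaced j (ltn_ord j)).2 real_normK ?num_real//.
by field; rewrite mR gt_eqF.
Qed.

Lemma block_cost_ge (b : {set 'I_m}) (y : space3 R) :
  h ^+ 2 * inertia #|b| <= \sum_(j in b) (d (x j) y) ^+ 2.
Proof. by rewrite sum_sqr_distE ler_wpM2l ?sqr_ge0// inertia_le_sum_sqr. Qed.

Lemma ex_block_mean (k l : nat) : (0 < l)%N -> (k + l <= m)%N ->
  exists2 y, A y & \sum_(j in [set j : 'I_m | (k <= j < k + l)%N]%SET) (d (x j) y) ^+ 2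
    = h ^+ 2 * inertia #|[set j : 'I_m | (k <= j < k + l)%N]%SET|.
Proof.
move=> l0 klm; have [Ax0 sx0] := x_spaced 0 m0.
have [|Axk sxk] := x_spaced (k + l).-1; first by lia.
have [/andP[+ _] _] := arc_coordP _ Ax0; rewrite sx0 mul0r addr0 => c0.
have h0 : 0 < h by rewrite divr_gt0// ltr0n.
have k0 : 0 <= k%:R :> R by [].
have l1 : 1 <= l%:R :> R by rewrite ler1n.
(* The mean coordinate of the block. It lies between 0 and the coordinate of the last point of the
   block, so [arc_coordK] ensures that the point with parameter [t] has coordinate [t] and not a
   smaller one. *)
pose t := c + (k%:R + (l%:R - 1) / 2) * h.
have tx : 0 <= t <= s (x (k + l).-1).
  have -> : s (x (k + l).-1) = t + (l%:R - 1) / 2 * h.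
    rewrite sxk /t.
    have -> : (k + l).-1%:R = k%:R + l%:R - 1 :> R.
      by rewrite -natrD -subn1 natrB// addn_gt0 l0 orbT.
    by field; rewrite pnatr_eq0 -lt0n.
  rewrite addr_ge0//=; last by rewrite mulr_ge0 ?(ltW h0)//; lra.
  by rewrite lerDl mulr_ge0 ?(ltW h0)//; lra.
exists (great_circle u v t).
  apply: circle_arc_great_circle; have [/andP[_ sL] _] := arc_coordP _ Axk.
  by case/andP: tx => -> /le_trans ->.
rewrite sum_sqr_distE (arc_coordK uv _ _ Axk tx) sum_sqr_block// card_ord_block//.
congr (_ * _); rewrite [X in _ + X](_ : _ = 0) ?addr0//.
by rewrite /t [c + _]addrC addrK mulfK ?gt_eqF// subrr expr0n mulr0.
Qed.

Section clusterings.
Context {n : nat} {B : {set {set 'I_m}}}.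
Hypothesis clB : clustering n B.

Lemma clustering_cost_ge (p : nat) (f : {set 'I_m} -> space3 R) :
  h ^+ 2 * balanced_inertia n m p <= clustering_cost d x B f.
Proof.
apply: le_trans (ler_sum _ (fun b _ => block_cost_ge b (f b))).
rewrite -mulr_sumr ler_wpM2l ?sqr_ge0//.
exact: balanced_inertia_le clB.2 (clustering_sum_card clB).
Qed.

Hypothesis contB : contiguous n B.

(** On a contiguous block the lower bound [block_cost_ge] is attained at the mean, so being a
    minimizer amounts to reaching it. The cost of such a clustering is therefore the same for every
    choice of centers. *)
Lemma block_is_center (b : {set 'I_m}) (y : space3 R) : b \in B -> A y ->
  is_center A d x b y <-> \sum_(j in b) (d (x j) y) ^+ 2 = h ^+ 2 * inertia #|b|.
Proof.
move=> bB Ay; split=> [[_ ymin]|yE]; last first.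
  by split=> // y' _; rewrite yE block_cost_ge.
have [k [l [l0 klm eb]]] := contiguous_block clB contB bB.
have [z Az zE] := ex_block_mean k l l0 klm.
apply/eqP; rewrite eq_le block_cost_ge andbT.
by rewrite (le_trans (ymin _ Az))// eb zE.
Qed.

Lemma ex_are_centers : exists f, are_centers A d x B f.
Proof.
have /choice[f fP] : forall b : {set 'I_m}, exists y : space3 R,
    b \in B -> is_center A d x b y.
  (* Outside [B] the value [x 0] is a dummy. *)
  move=> b; have [bB|_] := boolP (b \in B); last by exists (x 0).
  have [k [l [l0 klm eb]]] := contiguous_block clB contB bB.
  have [z Az zE] := ex_block_mean k l l0 klm.
  by exists z => _; apply/block_is_center => //; rewrite eb zE.
by exists f => b bB; exact: fP.
Qed.

Hypothesis balB : balanced B.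

Lemma balanced_clustering_cost (f : {set 'I_m} -> space3 R) :
  are_centers A d x B f ->
  clustering_cost d x B f = h ^+ 2 * balanced_inertia n m (m %/ n).
Proof.
move=> fP; rewrite /clustering_cost.
under eq_bigr => b bB.
  rewrite (iffLR (block_is_center b (f b) bB (fP b bB).1) (fP b bB)).
  over.
rewrite -mulr_sumr; congr (_ * _).
apply: balanced_inertia_eq clB.2 (clustering_sum_card clB) _ => b bB.
exact: balanced_card clB balB bB.
Qed.

End clusterings.

Lemma distortionE (a : set (space3 R)) : finite_set a ->
  distortion A d PX a = ((m%:R^-1)%:E *
    \sum_(j < m) ereal_inf [set ((d (x j) y) ^+ 2)%:E | y in a])%E.
Proof.
move=> fina; apply: integral_discrete_uniform.
- exact: measurable_circle_arc.
- exact: measurable_sqr_dist_to.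
- by move=> y _; apply: le_ereal_inf_tmp => _ [z _ <-]; rewrite lee_fin sqr_ge0.
- by move=> j /x_spaced[].
Qed.

(** An inclusion suffices for lower bounds and also accommodates the empty codebook, for which [e]
    is a constant. *)
Lemma codebook_enum {n : nat} {a : set (space3 R)} : codebooks A n a ->
  exists e : nat -> space3 R, a `<=` e @` `I_n.
Proof.
move=> [_ /pfcard_geP[->|/surjfunPex[e ->]]]; last by exists e.
by exists (fun=> point) => ? [].
Qed.

Lemma codebook_finite {n : nat} {a : set (space3 R)} :
  codebooks A n a -> finite_set a.
Proof. by move=> [_ an]; exact: card_le_finite an (finite_II n). Qed.

(** Sending each index to a nearest [e i] splits the indices into n Voronoi cells, possibly empty,
    whose sizes sum to m. Each cell costs at least its inertia, wherever [e i] lies. *)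
Lemma distortion_ge (n p : nat) (a : set (space3 R)) : (0 < n)%N ->
  codebooks A n a ->
  ((m%:R^-1 * (h ^+ 2 * balanced_inertia n m p))%:E <= distortion A d PX a)%E.
Proof.
move=> n0 ca; have [e ae] := codebook_enum ca.
rewrite distortionE; last exact: codebook_finite ca.
rewrite EFinM lee_wpmul2l ?lee_fin ?invr_ge0//.
have /choice[phi phiP] : forall j : 'I_m, exists i : 'I_n, forall i' : 'I_n,
    (d (x j) (e i)) ^+ 2 <= (d (x j) (e i')) ^+ 2.
  move=> j.
  case: (@Order.TotalTheory.arg_minP _ _ _ (Ordinal n0) xpredT
    (fun i => (d (x j) (e i)) ^+ 2) isT) => i _ imin.
  by exists i => i'; exact: imin.
apply: (@le_trans _ _ (\sum_(j < m) (d (x j) (e (phi j))) ^+ 2)%:E); last first.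
  rewrite -sumEFin; apply: lee_sum => j _.
  apply: le_ereal_inf_tmp => _ [y /ae[i lt_in <-] <-]; rewrite lee_fin.
  exact: phiP (Ordinal lt_in).
rewrite lee_fin (partition_big phi xpredT)//=.
pose b i := [set j | phi j == i]%SET.
apply: (@le_trans _ _ (\sum_(i < n) h ^+ 2 * inertia #|b i|)).
  rewrite -mulr_sumr ler_wpM2l ?sqr_ge0//.
  apply: balanced_inertia_le; first by rewrite card_ord.
  rewrite -[RHS]card_ord -sum1_card (partition_big phi xpredT)//=.
  by apply: eq_bigr => i _; rewrite -sum1_card; apply: eq_bigl => j; rewrite inE.
apply: ler_sum => i _; apply: le_trans (block_cost_ge (b i) (e i)) _.
rewrite le_eqVlt; apply/orP; left; apply/eqP.
by apply: eq_big => [j|j]; rewrite inE// => /eqP ->.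
Qed.

Lemma quantization_error_ge (n p : nat) : (0 < n)%N ->
  ((m%:R^-1 * (h ^+ 2 * balanced_inertia n m p))%:E <=
   quantization_error A d PX n)%E.
Proof.
by move=> n0; apply: le_ereal_inf_tmp => _ [a ca <-]; exact: distortion_ge.
Qed.

Section means.
Context {n : nat} {B : {set {set 'I_m}}} {f : {set 'I_m} -> space3 R}.
Hypothesis clB : clustering n B.
Hypothesis fP : are_centers A d x B f.

Lemma codebooks_centers : codebooks A n [set f b | b in [set` B]].
Proof.
split; first by move=> y [b bB <-]; case: (fP b bB).
have -> : [set f b | b in [set` B]] =
    (fun i => f (nth finset.set0 (enum B) i)) @` `I_n.
  have sB : size (enum B) = n by rewrite -cardE clB.2.
  apply/seteqP; split=> y [].
    move=> b /= bB <-; have bE : b \in enum B by rewrite mem_enum.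
    by exists (index b (enum B)); rewrite ?nth_index//= -sB index_mem.
  move=> i /= lt_in <-; exists (nth finset.set0 (enum B) i) => //=.
  by rewrite -mem_enum mem_nth// sB.
exact: card_image_le.
Qed.

(** An inequality, because a point may be nearer to the center of another block than to its own. *)
Lemma distortion_centers_le :
  (distortion A d PX [set f b | b in [set` B]] <=
   (m%:R^-1 * clustering_cost d x B f)%:E)%E.
Proof.
rewrite distortionE; last exact: codebook_finite codebooks_centers.
rewrite EFinM lee_wpmul2l ?lee_fin ?invr_ge0//.
have -> : (\sum_(j < m) ereal_inf
      [set ((d (x j) y) ^+ 2)%:E | y in [set f b | b in [set` B]]] =
    \sum_(j in [set: 'I_m]%SET) ereal_inf
      [set ((d (x j) y) ^+ 2)%:E | y in [set f b | b in [set` B]]])%E.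
  by apply: eq_bigl => j; rewrite inE.
rewrite (set_partition_big _ clB.1)/= /clustering_cost -sumEFin.
apply: lee_sum => b bB; rewrite -sumEFin; apply: lee_sum => j jb.
by apply: ereal_inf_lbound; exists (f b) => //; exists b.
Qed.

End means.

Section balanced_clustering.
Context {n : nat} {B : {set {set 'I_m}}}.
Hypothesis n0 : (0 < n)%N.
Hypothesis clB : clustering n B.
Hypothesis contB : contiguous n B.
Hypothesis balB : balanced B.

Lemma balanced_optimal_clustering : optimal_clustering A d x n B.
Proof.
split=> //; have [f fP] := ex_are_centers clB contB; exists f => // B' f' clB' _.
by rewrite (balanced_clustering_cost clB contB balB _ fP) clustering_cost_ge.
Qed.

(** The lower bound with p = m / n, the quantization error, the distortion of the centers and the
    clustering cost over m form a chain of inequalities whose two ends agree. *)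
Lemma distortion_balanced_centers (f : {set 'I_m} -> space3 R) :
  are_centers A d x B f ->
  optimal_set_of_means A d PX n [set f b | b in [set` B]] /\
  quantization_error A d PX n =
    (m%:R^-1 * (h ^+ 2 * balanced_inertia n m (m %/ n)))%:E.
Proof.
move=> fP; have cB := codebooks_centers clB fP.
have qe_le : (quantization_error A d PX n <=
    distortion A d PX [set f b | b in [set` B]])%E.
  by apply: ereal_inf_lbound; exists [set f b | b in [set` B]].
have dist_le := distortion_centers_le clB fP.
rewrite (balanced_clustering_cost clB contB balB _ fP) in dist_le.
have qe_ge := quantization_error_ge n (m %/ n) n0.
split; last by apply/eqP; rewrite eq_le qe_ge (le_trans qe_le).
split=> //; apply/eqP; rewrite eq_le qe_le andbT.
exact: le_trans dist_le qe_ge.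
Qed.

End balanced_clustering.

Lemma quantization_errorE (n : nat) : (0 < n)%N -> (n <= m)%N ->
  quantization_error A d PX n =
    (m%:R^-1 * (h ^+ 2 * balanced_inertia n m (m %/ n)))%:E.
Proof.
move=> n0 nm; have [B [clB contB balB]] := ex_balanced_clustering n0 nm.
have [f fP] := ex_are_centers clB contB.
by case: (distortion_balanced_centers n0 clB contB balB _ fP).
Qed.

End equally_spaced_points.

Theorem theorem6p5 (R : realType) (u v : 'rV[R]_3) (L : R) (n : nat) :
  orthonormal_pair u v -> 0 < L -> L <= 2 * pi -> (0 < n)%N ->
  let A := circle_arc u v L in
  let d := dG u v L in
  (forall (m : nat) (x : nat -> space3 R),
    (n <= m)%N -> equally_spaced u v L m x ->
    let PX : {measure set (space3 R) -> \bar R} := discrete_uniform m x in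
    [/\ (exists B : {set {set 'I_m}},
          [/\ clustering n B, contiguous n B & balanced B]),
        (forall B : {set {set 'I_m}},
          clustering n B -> contiguous n B -> balanced B ->
          optimal_clustering A d x n B /\
          forall c : {set 'I_m} -> space3 R, are_centers A d x B c ->
            optimal_set_of_means A d PX n [set c b | b in [set` B]]) &
        ((n %| m)%N ->
          (forall (B : {set {set 'I_m}}) (b : {set 'I_m}),
            clustering n B -> contiguous n B -> balanced B -> b \in B ->
            #|b| = (m %/ n)%N /\ #|b|%:R * (L / m%:R) = L / n%:R) /\
          quantization_error A d PX n =
            (m%:R^-1 * (n%:R * \sum_(i < m %/ n)
              ((i%:R - ((m %/ n)%:R - 1) / 2) * L / m%:R) ^+ 2))%:E)]) /\
  (forall X : nat -> nat -> space3 R,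
    (forall q, (0 < q)%N -> equally_spaced u v L (n * q) (X q)) ->
    quantization_error A d
      (discrete_uniform (n * q) (X q) : {measure set (space3 R) -> \bar R}) n
      @[q --> \oo] --> (L ^+ 2 / (12 * n%:R ^+ 2))%:E).
Proof.
move=> uv L0 _ n0 A d; split=> [m x nm [c xP] PX|X XP].
  have m0 : (0 < m)%N := leq_trans n0 nm.
  split; first exact: ex_balanced_clustering.
    move=> B clB contB balB.
    split; first exact (balanced_optimal_clustering uv L0 m0 xP clB contB balB).
    by move=> f fP; case: (distortion_balanced_centers uv L0 m0 xP n0 clB contB balB _ fP).
  move=> nm_dvd; split=> [B b clB _ balB bB|].
    have bE := balanced_card_dvd clB balB bB nm_dvd; split=> //.
    rewrite bE -[in X in _ / X](divnK nm_dvd) natrM.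
    by field; rewrite !pnatr_eq0 -!lt0n divn_gt0// n0.
  rewrite (quantization_errorE uv L0 m0 xP)//; congr (_ * _)%:E.
  rewrite -[in X in balanced_inertia n X](divnK nm_dvd) mulnC balanced_inertia_dvd.
  rewrite mulrCA; congr (_ * _).
  transitivity (\sum_(i < m %/ n) (L / m%:R) ^+ 2 *
      (i%:R - ((m %/ n)%:R - 1) / 2) ^+ 2); last first.
    by apply: eq_bigr => i _; rewrite -exprMn; congr (_ ^+ 2); rewrite mulrC mulrA.
  (* The summation indices are centred at their mean, so the parallel axis term vanishes. *)
  by rewrite -mulr_sumr sum_sqr_ord subrr expr0n mulr0 addr0.
(* For q > 0 the error has this closed form, obtained from n [inertia q] (L / (n q))^2 / (n q); only
   the factor 1 - 1 / q^2 depends on q. *)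
apply: (@cvg_trans _ ((L ^+ 2 / (12 * n%:R ^+ 2) * (1 - q%:R^-1 ^+ 2))%:E @[q --> \oo])).
  apply: near_eq_cvg; near=> q.
  have q0 : (0 < q)%N by near: q; exact: nbhs_infty_gt.
  have [c xP] := XP q q0.
  have nq0 : (0 < n * q)%N by rewrite muln_gt0 n0.
  rewrite (quantization_errorE uv L0 nq0 xP) ?leq_pmulr// mulKn// balanced_inertia_dvd.
  congr _%:E; rewrite /inertia natrM; field.
  by rewrite !pnatr_eq0 -!lt0n q0 n0.
apply: cvg_EFin; first by near=> q.
rewrite -[X in _ --> X]mulr1; apply: cvgM; first exact: cvg_cst.
rewrite -[X in _ --> X]subr0; apply: cvgB; first exact: cvg_cst.
rewrite -[X in _ --> X](mulr0 0); under eq_cvg do rewrite expr2.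
have inv_cvg : (q%:R^-1 : R) @[q --> \oo] --> 0.
  apply/gtr0_cvgV0; last exact: cvgr_idn.
  by near=> q; rewrite ltr0n; near: q; exact: nbhs_infty_gt.
exact: cvgM.
Unshelve. all: by end_near.
Qed.
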